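(* Let $A\in\mathbb{R}^{n_x\times n_x}$, $B\in\mathbb{R}^{n_x\times n_u}$, $g\in\mathbb{R}^{n_x}$, let $\Omega=\mathrm{co}\{\omega_1,\dots,\omega_{N_\omega}\}\subset\mathbb{R}^{n_x}$, and consider the affine system $$x(k+1)=Ax(k)+Bu(k)+g+\omega(k),\qquad \omega(k)\in\Omega .$$ Let $P,P_+\in\mathbb{R}^{n_x\times n_x}$ be symmetric positive definite, $c,c_+\in\mathbb{R}^{n_x}$, and $$\mathbb{B}_s=\{x\in\mathbb{R}^{n_x}: (x-c)^\top P(x-c)\le 1\},\qquad \mathbb{B}_f=\{x\in\mathbb{R}^{n_x}: (x-c_+)^\top P_+(x-c_+)\le 1\}.$$ Let $U_1,\dots,U_{N_u}$ be given real matrices with $n_u$ columns and $\mathcal{U}=\bigcap_{i=1}^{N_u}\{u\in\mathbb{R}^{n_u}:\|U_iu\|_2\le1\}$. Let $Q=L^\top L$ be a positive semidefinite matrix of size $n_x+n_u+1$ and let $$\mathcal{J}(x,u)=\begin{bmatrix} x \\ u \\ 1 \end{bmatrix}^\top Q\begin{bmatrix} x \\ u \\ 1 \end{bmatrix}.$$ Consider the convex optimization problem of minimizing $\widetilde{\mathcal{J}}$ over $K\in\mathbb{R}^{n_u\times n_x}$, $\ell\in\mathbb{R}^{n_u}$, $\beta_1,\dots,\beta_{N_\omega}\ge0$, $\tau_1,\dots,\tau_{N_u}\ge0$, $\gamma\ge0$, $\widetilde{\mathcal{J}}\ge0$ subject to $$\begin{bmatrix}\beta_iP & 0 & (A+BK)^\top\\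 0 & 1-\beta_i & \mu_i^\top\\ A+BK & \mu_i & P_+^{-1}\end{bmatrix}\succeq 0,\quad i\in\{1,\dots,N_\omega\},\qquad \mu_i=g+Ac+B\ell+\omega_i-c_+,$$ $$\begin{bmatrix}\tau_iP & 0 & K^\top U_i^\top\\ 0 & 1-\tau_i & \ell^\top U_i^\top\\ U_iK & U_i\ell & I\end{bmatrix}\succeq 0,\quad i\in\{1,\dots,N_u\},$$ $$\begin{bmatrix}\gamma P & 0 & [\,I\ \ K^\top\ \ 0\,]L^\top\\ 0 & \widetilde{\mathcal{J}}-\gamma & [\,c^\top\ \ \ell^\top\ \ 1\,]L^\top\\ L[\,I\ \ K^\top\ \ 0\,]^\top & L[\,c^\top\ \ \ell^\top\ \ 1\,]^\top & I\end{bmatrix}\succeq0 .$$ If $(K,\ell,(\beta_i),(\tau_i),\gamma,\widetilde{\mathcal{J}})$ is an optimal solution of this problem and $\kappa(x)=K(x-c)+\ell$, then $$\widetilde{\mathcal{J}}=\max_{x\in\mathbb{B}_s}\mathcal{J}(x,\kappa(x)),$$ and $\kappa$ ensures a transition from $\mathbb{B}_s$ to $\mathbb{B}_f$, that is, for all $x\in\mathbb{B}_s$ one has $\kappa(x)\in\mathcal{U}$ and $Ax+B\kappa(x)+g+\omega\in\mathbb{B}_f$ for every $\omega\in\Omega$.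
   Context: $\mathrm{co}\{\cdot\}$ denotes the convex hull of finitely many points; $X\succeq0$ means that the symmetric matrix $X$ is positive semidefinite. $I$ denotes an identity matrix of appropriate size; in the last matrix inequality, $[\,I\ \ K^\top\ \ 0\,]$ is the $n_x\times(n_x+n_u+1)$ matrix with blocks $I\in\mathbb{R}^{n_x\times n_x}$, $K^\top\in\mathbb{R}^{n_x\times n_u}$ and $0\in\mathbb{R}^{n_x\times1}$, and $[\,c^\top\ \ \ell^\top\ \ 1\,]$ is a row vector of length $n_x+n_u+1$. $L$ is a fixed real matrix with $n_x+n_u+1$ columns. *)

(* Defs.v *)
From mathcomp Require Import all_boot all_order all_algebra.
From mathcomp Require Import classical_sets reals.

Set Implicit Arguments.
Unset Strict Implicit.
Unset Printing Implicit Defensive.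

Import Order.TTheory GRing.Theory Num.Theory.
Local Open Scope classical_set_scope.
Local Open Scope ring_scope.

(* Vectors of R^n are columns 'cV[R]_n; all dimensions may be zero. *)

Definition quad_form (R : realType) (n : nat) (X : 'M[R]_n) (v : 'cV[R]_n) : R :=
  (v^T *m X *m v) 0 0.

Definition psd (R : realType) (n : nat) (X : 'M[R]_n) : Prop :=
  X \is symmetricmx /\ forall v : 'cV[R]_n, 0 <= quad_form X v.

Definition posdef (R : realType) (n : nat) (X : 'M[R]_n) : Prop :=
  X \is symmetricmx /\ forall v : 'cV[R]_n, v != 0 -> 0 < quad_form X v.

(* The norm `|v| that MathComp-Analysis puts on matrices is the sup norm. *)
Definition norm2 (R : realType) (n : nat) (v : 'cV[R]_n) : R :=
  Num.sqrt (\sum_(i < n) v i 0 ^+ 2).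

Definition convex_hull (R : realType) (n N : nat) (w : 'I_N -> 'cV[R]_n) :
    set 'cV[R]_n :=
  [set v | exists a : 'I_N -> R,
     [/\ forall i, 0 <= a i, \sum_(i < N) a i = 1
       & v = \sum_(i < N) a i *: w i]].

Definition ellipsoid (R : realType) (n : nat) (P : 'M[R]_n) (c : 'cV[R]_n) :
    set 'cV[R]_n :=
  [set x | quad_form P (x - c) <= 1].

(* The matrices U i may have different numbers p i of rows. *)
Definition input_set (R : realType) (nu Nu : nat) (p : 'I_Nu -> nat)
    (U : forall i, 'M[R]_(p i, nu)) : set 'cV[R]_nu :=
  \bigcap_i [set u | norm2 (U i *m u) <= 1].

Definition stage_cost (R : realType) (nx nu : nat) (Q : 'M[R]_(nx + nu + 1))
    (x : 'cV[R]_nx) (u : 'cV[R]_nu) : R :=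
  quad_form Q (col_mx (col_mx x u) 1%:M).

Definition affine_step (R : realType) (nx nu : nat) (A : 'M[R]_nx)
    (B : 'M[R]_(nx, nu)) (g x : 'cV[R]_nx) (u : 'cV[R]_nu) (w : 'cV[R]_nx) :
    'cV[R]_nx :=
  A *m x + B *m u + g + w.

Definition controller (R : realType) (nx nu : nat) (K : 'M[R]_(nu, nx))
    (l : 'cV[R]_nu) (c x : 'cV[R]_nx) : 'cV[R]_nu :=
  K *m (x - c) + l.

Definition block3_mx (R : Type) (m1 m2 m3 n1 n2 n3 : nat)
    (X11 : 'M[R]_(m1, n1)) (X12 : 'M[R]_(m1, n2)) (X13 : 'M[R]_(m1, n3))
    (X21 : 'M[R]_(m2, n1)) (X22 : 'M[R]_(m2, n2)) (X23 : 'M[R]_(m2, n3))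
    (X31 : 'M[R]_(m3, n1)) (X32 : 'M[R]_(m3, n2)) (X33 : 'M[R]_(m3, n3)) :
    'M[R]_(m1 + m2 + m3, n1 + n2 + n3) :=
  block_mx (block_mx X11 X12 X21 X22) (col_mx X13 X23)
           (row_mx X31 X32)           X33.

Definition transition_lmi (R : realType) (nx nu : nat) (A : 'M[R]_nx)
    (B : 'M[R]_(nx, nu)) (g : 'cV[R]_nx) (P Pf : 'M[R]_nx) (c cf w : 'cV[R]_nx)
    (K : 'M[R]_(nu, nx)) (l : 'cV[R]_nu) (b : R) : 'M[R]_(nx + 1 + nx) :=
  let mu := g + A *m c + B *m l + w - cf in
  block3_mx (b *: P)     0             (A + B *m K)^T
            0            (1 - b)%:M    mu^T
            (A + B *m K) mu            (invmx Pf).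

Definition input_lmi (R : realType) (nx nu p : nat) (P : 'M[R]_nx)
    (Ui : 'M[R]_(p, nu)) (K : 'M[R]_(nu, nx)) (l : 'cV[R]_nu) (t : R) :
    'M[R]_(nx + 1 + p) :=
  block3_mx (t *: P)  0           (K^T *m Ui^T)
            0         (1 - t)%:M  (l^T *m Ui^T)
            (Ui *m K) (Ui *m l)   1%:M.

Definition cost_lmi (R : realType) (nx nu q : nat) (P : 'M[R]_nx)
    (c : 'cV[R]_nx) (L : 'M[R]_(q, nx + nu + 1)) (K : 'M[R]_(nu, nx))
    (l : 'cV[R]_nu) (y J : R) : 'M[R]_(nx + 1 + q) :=
  let G : 'M[R]_(nx, nx + nu + 1) := row_mx (row_mx 1%:M K^T) 0 in
  let h : 'M[R]_(1, nx + nu + 1) := row_mx (row_mx c^T l^T) 1%:M in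
  block3_mx (y *: P)    0            (G *m L^T)
            0           (J - y)%:M   (h *m L^T)
            (L *m G^T)  (L *m h^T)   1%:M.

Record decision (R : realType) (nx nu Nw Nu : nat) := Decision {
  gain : 'M[R]_(nu, nx);
  offset : 'cV[R]_nu;
  beta : 'I_Nw -> R;
  tau : 'I_Nu -> R;
  gamma : R;
  cost_bound : R }.

Definition feasible (R : realType) (nx nu Nw Nu q : nat) (p : 'I_Nu -> nat)
    (A : 'M[R]_nx) (B : 'M[R]_(nx, nu)) (g : 'cV[R]_nx)
    (w : 'I_Nw -> 'cV[R]_nx) (P Pf : 'M[R]_nx) (c cf : 'cV[R]_nx)
    (U : forall i, 'M[R]_(p i, nu)) (L : 'M[R]_(q, nx + nu + 1)) :
    set (decision R nx nu Nw Nu) :=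
  [set d |
    [/\ forall i, 0 <= beta d i, forall i, 0 <= tau d i,
        0 <= gamma d & 0 <= cost_bound d] /\
    [/\ forall i, psd (transition_lmi A B g P Pf c cf (w i)
                         (gain d) (offset d) (beta d i)),
        forall i, psd (input_lmi P (U i) (gain d) (offset d) (tau d i))
      & psd (cost_lmi P c L (gain d) (offset d) (gamma d) (cost_bound d))]].

Definition is_minimizer (R : realType) (T : Type) (f : T -> R) (D : set T)
    (d : T) : Prop :=
  D d /\ forall d', D d' -> f d <= f d'.

Definition is_maximum (R : realType) (E : set R) (m : R) : Prop :=
  E m /\ ubound E m.

(* Main.v *)
(* With v = M z + b, a block matrix [y P, 0, M^T; 0, J - y, b^T; M, b, S^-1],
   evaluated at (z, 1, - S v), gives v^T S v <= J - y (1 - z^T P z).  This is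
   the bound by J on the ellipsoid, for each of the three matrix inequalities;
   convexity of the quadratic form extends the transition bound from the
   vertices of the disturbance set to its convex hull.
   For tightness, the convex function |M z + b|^2 attains its maximum J' on the
   compact ellipsoid, and the S-lemma turns
   "z^T P z <= t^2 implies |M z + t b|^2 <= J' t^2" into a multiplier y' for
   which the cost inequality holds with the bound J'.  Replacing only y and the
   bound in the optimal solution keeps it feasible, so optimality yields
   that the optimal bound is at most J'. *)
Require Import Defs.
From mathcomp Require Import all_boot all_order all_algebra.
From mathcomp Require Import classical_sets reals.
From mathcomp Require Import boolp topology normedtype derive.
From mathcomp Require Import ring lra.

Import Order.TTheory GRing.Theory Num.Theory.
Import numFieldNormedType.Exports.
Local Open Scope classical_set_scope.
Local Open Scope ring_scope.

(** * The S-lemma for quadratic functions on a module *)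

(** Only restrictions to lines matter: each is a polynomial of degree at most two whose leading
    coefficient is the value at the direction. *)
Definition quadratic {R : pzRingType} {V : lmodType R} (F : V -> R) :=
  forall u v, exists b, forall s, F (u + s *: v) = F u + s * b + s ^+ 2 * F v.

(* The line through u and v meets {G = 0} at two points, where F <= 0; the
   positive combination of these two inequalities that cancels the cross term
   of F is the claim. *)
Lemma s_lemma_ratio (R : rcfType) (V : lmodType R) (F G : V -> R) (u v : V) :
  quadratic F -> quadratic G -> (forall y, G y <= 0 -> F y <= 0) ->
  0 < G u -> G v < 0 -> F v * G u <= F u * G v.
Proof.
move=> qF qG GF Gu Gv.
have [f hf] := qF u v; have [b hb] := qG u v.
(* [D] is the discriminant of [G] along the line; as [G u] and [G v] have opposite signs, it exceeds
   [b ^+ 2]. *)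
pose D := b ^+ 2 - 4 * G u * G v; pose r := Num.sqrt D.
have Dgt : b ^+ 2 < D by rewrite /D; nra.
have r2 : r ^+ 2 = D by rewrite sqr_sqrtr // (le_trans _ (ltW Dgt)) ?sqr_ge0.
have /ltr_normlP[Nbr br] : `|b| < r.
  rewrite -ltr_sqr ?nnegrE ?sqrtr_ge0 //.
  by rewrite real_normK ?num_real // r2.
have Gv0 : G v != 0 by rewrite lt_eqF.
have root e : e ^+ 2 = 1 ->
    4 * G v ^+ 2 * F u + 2 * G v * (- b + e * r) * f
      + (- b + e * r) ^+ 2 * F v <= 0.
  (* The two choices [e = 1] and [e = -1] give the two roots [s] of [G] on the line. *)
  move=> e2; pose s := (- b + e * r) / (2 * G v).
  have : F (u + s *: v) <= 0.
    apply: GF; rewrite hb le_eqVlt; apply/orP; left.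
    apply/eqP; transitivity ((e ^+ 2 * r ^+ 2 - D) / (4 * G v)).
      by rewrite /D /s; field.
    by rewrite e2 r2 mul1r subrr mul0r.
  rewrite hf => H.
  have -> : 4 * G v ^+ 2 * F u + 2 * G v * (- b + e * r) * f
      + (- b + e * r) ^+ 2 * F v
    = 4 * G v ^+ 2 * (F u + s * f + s ^+ 2 * F v) by rewrite /s; field.
  by apply: mulr_ge0_le0 => //; rewrite mulr_ge0 ?sqr_ge0.
have H1 := root 1 (expr1n _ _).
have H2 : 4 * G v ^+ 2 * F u + 2 * G v * (- b - r) * f
      + (- b - r) ^+ 2 * F v <= 0.
  by rewrite -(mulN1r r); apply: root; rewrite sqrrN expr1n.
rewrite mul1r in H1.
have r0 : 0 < r by lra.
(* The weights [r + b] and [r - b] are positive since [|b| < r], and they make the terms in [f]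
   cancel. *)
have : 8 * (G v * r) * (F u * G v - F v * G u) <= 0.
  have -> : 8 * (G v * r) * (F u * G v - F v * G u) =
    (r + b) * (4 * G v ^+ 2 * F u + 2 * G v * (- b + r) * f
      + (- b + r) ^+ 2 * F v) +
    (r - b) * (4 * G v ^+ 2 * F u + 2 * G v * (- b - r) * f
      + (- b - r) ^+ 2 * F v).
    have -> : 8 * (G v * r) * (F u * G v - F v * G u) =
      8 * r * G v ^+ 2 * F u + 2 * r * F v * (D - b ^+ 2) by rewrite /D; ring.
    by rewrite -r2; ring.
  by rewrite -[leRHS](addr0 0) lerD // mulr_ge0_le0 //; lra.
rewrite nmulr_rle0 ?subr_ge0 // pmulr_rlt0 //.
by rewrite nmulr_rlt0.
Qed.

(** The multiplier is the supremum of the ratios [F u / G u] with [0 < G u]: by [s_lemma_ratio] none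
    exceeds a ratio taken where [G] is negative. Adjoining 0 makes the set nonempty and the supremum
    nonnegative. *)
Lemma s_lemma (R : realType) (V : lmodType R) (F G : V -> R) (v : V) :
  quadratic F -> quadratic G -> G v < 0 ->
  (forall y, G y <= 0 -> F y <= 0) ->
  exists2 m, 0 <= m & forall y, F y <= m * G y.
Proof.
move=> qF qG Gv GF.
pose E : set R := [set e | e = 0 \/ exists2 y, 0 < G y & e = F y / G y].
have E0 : E 0 by left.
have ubE y : G y < 0 -> ubound E (F y / G y).
  move=> Gy e [->|[u Gu ->]].
    by rewrite mulr_le0 ?invr_le0 ?GF // ltW.
  by rewrite ler_pdivrMr // mulrAC ler_ndivlMr // s_lemma_ratio.
have supE : has_sup E by split; [exists 0 | exists (F v / G v); exact: ubE].
exists (sup E); first exact: (sup_upper_bound supE).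
move=> y; have [Gy|Gy|Gy] := ltgtP (G y) 0.
- by rewrite -ler_ndivlMr //; apply: ge_sup; [exists 0 | exact: ubE].
- rewrite -ler_pdivrMr //; apply: (sup_upper_bound supE); right.
  by exists y.
- by rewrite Gy mulr0 GF // Gy.
Qed.

(** * Bilinear and quadratic forms of matrices *)

(** Rectangular [X] accommodates off-diagonal blocks; on the diagonal this is [quad_form] by
    conversion. *)
Definition bform {R : pzRingType} {m n : nat} (X : 'M[R]_(m, n))
    (u : 'cV[R]_m) (v : 'cV[R]_n) : R :=
  (u^T *m X *m v) 0 0.

Lemma bformDl (R : pzRingType) m n (X : 'M[R]_(m, n)) u1 u2 v :
  bform X (u1 + u2) v = bform X u1 v + bform X u2 v.
Proof. by rewrite /bform linearD /= !mulmxDl mxE. Qed.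

Lemma bformDr (R : pzRingType) m n (X : 'M[R]_(m, n)) u v1 v2 :
  bform X u (v1 + v2) = bform X u v1 + bform X u v2.
Proof. by rewrite /bform mulmxDr mxE. Qed.

Lemma bformZl (R : comPzRingType) m n (X : 'M[R]_(m, n)) a u v :
  bform X (a *: u) v = a * bform X u v.
Proof. by rewrite /bform linearZ /= -!scalemxAl mxE. Qed.

Lemma bformZr (R : comPzRingType) m n (X : 'M[R]_(m, n)) a u v :
  bform X u (a *: v) = a * bform X u v.
Proof. by rewrite /bform -scalemxAr mxE. Qed.

Lemma bform_tr (R : comPzRingType) m n (X : 'M[R]_(m, n)) u v :
  bform X^T v u = bform X u v.
Proof.
rewrite /bform.
have -> : (u^T *m X *m v) 0 0 = (u^T *m X *m v)^T 0 0 by rewrite [RHS]mxE.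
by rewrite !trmx_mul trmxK mulmxA.
Qed.

Lemma symmetricP (R : realType) n (X : 'M[R]_n) :
  reflect (X^T = X) (X \is symmetricmx).
Proof.
by apply: (iffP (is_hermitianmxP _ _ _)); rewrite expr0 scale1r map_mx_id.
Qed.

Lemma bform_sym (R : realType) n (X : 'M[R]_n) u v :
  X \is symmetricmx -> bform X v u = bform X u v.
Proof. by move=> /symmetricP sX; rewrite -{1}sX bform_tr. Qed.

Lemma quad_formDZ (R : realType) n (X : 'M[R]_n) u v s :
  quad_form X (u + s *: v) =
  quad_form X u + s * (bform X u v + bform X v u) + s ^+ 2 * quad_form X v.
Proof.
rewrite -![quad_form _ _]/(bform _ _ _) !(bformDl, bformDr, bformZl, bformZr).
by ring.
Qed.

Lemma quad_formZ (R : realType) n (X : 'M[R]_n) a u :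
  quad_form X (a *: u) = a ^+ 2 * quad_form X u.
Proof.
by rewrite -![quad_form _ _]/(bform _ _ _) bformZl bformZr expr2 mulrA.
Qed.

Lemma quad_form0 (R : realType) n (X : 'M[R]_n) : quad_form X 0 = 0.
Proof. by rewrite -(scale0r 0) quad_formZ expr0n mul0r. Qed.

Lemma quad_form_gram (R : realType) m n (X : 'M[R]_m) (M : 'M[R]_(m, n)) v :
  quad_form (M^T *m X *m M) v = quad_form X (M *m v).
Proof. by rewrite /quad_form trmx_mul !mulmxA. Qed.

Lemma quad_form1 (R : realType) n (v : 'cV[R]_n) :
  quad_form 1%:M v = \sum_(i < n) v i 0 ^+ 2.
Proof.
rewrite /quad_form mulmx1 mxE; apply: eq_bigr => i _.
by rewrite mxE expr2.
Qed.

Lemma quad_form1_ge0 (R : realType) n (v : 'cV[R]_n) : 0 <= quad_form 1%:M v.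
Proof. by rewrite quad_form1 sumr_ge0 // => i _; rewrite sqr_ge0. Qed.

Lemma posdef_psd (R : realType) n (X : 'M[R]_n) : posdef X -> psd X.
Proof.
move=> [sX pX]; split => // v; have [->|/pX/ltW //] := eqVneq v 0.
by rewrite quad_form0.
Qed.

Lemma posdef_unitmx (R : realType) n (X : 'M[R]_n) : posdef X -> X \in unitmx.
Proof.
move=> [sX pX]; rewrite -row_free_unit -kermx_eq0.
apply/eqP/eqP/rowV0P => v /sub_kermxP vX.
apply/eqP; apply: contraT => v0.
have := pX v^T; rewrite -(inj_eq (@trmx_inj _ _ _)) trmxK trmx0 => /(_ v0).
by rewrite /quad_form trmxK vX mul0mx mxE ltxx.
Qed.

(** A variance argument: with [m] the weighted mean, the weighted sum of the nonnegative values at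
    [v i - m] equals the weighted sum of the values at [v i] minus the value at [m]. *)
Lemma quad_form_convex (R : realType) n N (X : 'M[R]_n) (a : 'I_N -> R)
    (v : 'I_N -> 'cV[R]_n) (J : R) :
  psd X -> (forall i, 0 <= a i) -> \sum_i a i = 1 ->
  (forall i, quad_form X (v i) <= J) ->
  quad_form X (\sum_i a i *: v i) <= J.
Proof.
move=> [sX pX] a0 a1 vJ; set m := \sum_i _.
have suml u : \sum_i a i * bform X (v i) u = bform X m u.
  rewrite (big_morph (bform X ^~ u) (id1 := 0)
    (fun x y => bformDl R n n X x y u)).
    by apply: eq_bigr => i _; rewrite bformZl.
  by rewrite -(scale0r 0) bformZl mul0r.
have : 0 <= \sum_i a i * (quad_form X (v i) - 2 * bform X (v i) m
                          + quad_form X m).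
  apply: sumr_ge0 => i _; apply: mulr_ge0 => //.
  have := pX (v i + (-1) *: m).
  rewrite quad_formDZ (bform_sym _ _ _ (v i) m sX).
  by congr (_ <= _); ring.
under eq_bigr do rewrite mulrDr mulrBr mulrCA.
rewrite big_split sumrB -mulr_sumr suml -mulr_suml a1 /= mul1r.
rewrite -[bform X m m]/(quad_form X m) => H.
have : \sum_i a i * quad_form X (v i) <= \sum_i a i * J.
  by apply: ler_sum => i _; rewrite ler_wpM2l.
by rewrite -mulr_suml a1 mul1r; lra.
Qed.

(** * Matrix inequalities of Schur complement type *)

(** Common shape of the three constraints: [transition_lmi] has it by conversion, the others by
    [input_lmiE] and [cost_lmiE]. *)
Definition schur_mx {R : realType} {m n : nat} (X : 'M[R]_m) (a : R)
    (M : 'M[R]_(n, m)) (b : 'cV[R]_n) (Y : 'M[R]_n) : 'M[R]_(m + 1 + n) :=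
  block3_mx X 0 M^T 0 a%:M b^T M b Y.

Lemma quad_form_block (R : realType) m n (A : 'M[R]_m) B C (D : 'M[R]_n) x y :
  quad_form (block_mx A B C D) (col_mx x y) =
  quad_form A x + bform B x y + bform C y x + quad_form D y.
Proof.
rewrite /bform /quad_form tr_col_mx mul_row_block mul_row_col !mulmxDl.
have mxD (V W : 'M[R]_1) : (V + W) 0 0 = V 0 0 + W 0 0 by rewrite mxE.
by rewrite !mxD; ring.
Qed.

Lemma quad_form_schur (R : realType) m n X a (M : 'M[R]_(n, m)) b Y z t s :
  quad_form (schur_mx X a M b Y) (col_mx (col_mx z t%:M) s) =
  quad_form X z + t ^+ 2 * a + 2 * bform 1%:M s (M *m z + t *: b)
  + quad_form Y s.
Proof.
rewrite /schur_mx /block3_mx !quad_form_block -tr_row_mx bform_tr.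
have -> : bform (row_mx M b) s (col_mx z t%:M) =
    bform 1%:M s (M *m z + t *: b).
  by rewrite /bform -mulmxA mul_row_col mul_mx_scalar mulmx1.
have -> : quad_form a%:M (t%:M : 'cV_1) = t ^+ 2 * a.
  by rewrite /quad_form tr_scalar_mx -!scalar_mxM mxE eqxx mulr1n; ring.
by rewrite /bform !mulmx0 !mul0mx mxE; ring.
Qed.

(** The relation [S *m T *m S = S] covers both uses: [S = T = 1] and [S = Pf] with [T] its
    inverse. *)
Lemma schur_mx_bound (R : realType) m n (P : 'M[R]_m) (S T : 'M[R]_n) M b y J
    (z : 'cV[R]_m) :
  S \is symmetricmx -> S *m T *m S = S -> 0 <= y ->
  psd (schur_mx (y *: P) (J - y) M b T) -> quad_form P z <= 1 ->
  quad_form S (M *m z + b) <= J.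
Proof.
move=> /symmetricP sS STS y0 [_ pX] Pz.
set v := M *m z + b.
have := pX (col_mx (col_mx z 1%:M) (- 1 *: (S *m v))).
rewrite quad_form_schur scale1r -/v quad_formZ -quad_form_gram sS STS.
have -> : bform 1%:M (- 1 *: (S *m v)) v = - quad_form S v.
  by rewrite bformZl /bform trmx_mul sS mulmx1 mulN1r.
have -> : quad_form (y *: P) z = y * quad_form P z.
  by rewrite /quad_form -scalemxAr -scalemxAl mxE.
have := ler_wpM2l y0 Pz.
by lra.
Qed.

(** Completing the square in the last block [s] leaves exactly the assumed inequality in [z] and
    [t]. *)
Lemma schur_mx_psd (R : realType) m n (P : 'M[R]_m) (M : 'M[R]_(n, m)) b y J :
  P \is symmetricmx ->
  (forall z t, quad_form 1%:M (M *m z + t *: b) - J * t ^+ 2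
                 <= y * (quad_form P z - t ^+ 2)) ->
  psd (schur_mx (y *: P) (J - y) M b 1%:M).
Proof.
move=> /symmetricP sP H; split.
  apply/symmetricP; rewrite /schur_mx /block3_mx !tr_block_mx tr_col_mx.
  by rewrite tr_row_mx linearZ /= sP !trmx0 !trmxK !tr_scalar_mx.
move=> v; rewrite -[v]vsubmxK -[usubmx v]vsubmxK.
rewrite (mx11_scalar (dsubmx (usubmx v))).
set s := dsubmx v; set t := _ 0 0; set z := usubmx _.
rewrite quad_form_schur.
have -> : quad_form (y *: P) z = y * quad_form P z.
  by rewrite /quad_form -scalemxAr -scalemxAl mxE.
have := quad_form1_ge0 _ _ (s + 1 *: (M *m z + t *: b)).
have s1 : (1%:M : 'M[R]_n) \is symmetricmx.
  by apply/symmetricP; rewrite tr_scalar_mx.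
rewrite quad_formDZ (bform_sym _ _ _ s _ s1) -/(bform _ _ _).
by have := H z t; lra.
Qed.

(** * Compactness of ellipsoids and attainment of the maximum *)

Lemma continuous_quad_form (R : realType) (T : topologicalType) n (X : 'M[R]_n)
    (F : T -> 'cV[R]_n) :
  (forall i, continuous (fun x => F x i 0)) ->
  continuous (fun x => quad_form X (F x)).
Proof.
move=> cF.
have -> : (fun x => quad_form X (F x)) =
    (fun x => \sum_j (\sum_i F x i 0 * X i j) * F x j 0).
  apply/funext => x; rewrite /quad_form mxE; apply: eq_bigr => j _.
  by rewrite mxE; congr (_ * _); apply: eq_bigr => i _; rewrite mxE.
apply: continuous_big => [|j _ x]; first exact: add_continuous.
apply: continuousM; last exact: cF.
apply: (continuous_big add_continuous) => i _ {}x.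
by apply: continuousM; [exact: cF | exact: cst_continuous].
Qed.

Lemma continuous_affine_coord (R : realType) m n (M : 'M[R]_(n, m)) b i :
  continuous (fun v : 'rV[R]_m => (M *m v^T + b) i 0).
Proof.
have -> : (fun v : 'rV[R]_m => (M *m v^T + b) i 0) =
    (fun v => \sum_j M i j * v 0 j + b i 0).
  apply/funext => v; rewrite !mxE; congr (_ + _).
  by apply: eq_bigr => j _; rewrite mxE.
move=> v; apply: continuousD; last exact: cst_continuous.
apply: (continuous_big add_continuous) => j _ {}v.
by apply: continuousM; [exact: cst_continuous | exact: coord_continuous].
Qed.

(* v_i = w^T P v with w = P^-1 e_i, and 2 w^T P v <= w^T P w + v^T P v. *)
Lemma posdef_coord_bounded (R : realType) n (P : 'M[R]_n) : posdef P ->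
  exists2 k, 0 <= k &
    forall (v : 'cV[R]_n) i, quad_form P v <= 1 -> `|v i 0| <= k.
Proof.
move=> hP; have [sP pP] := posdef_psd _ _ _ hP.
pose w i : 'cV[R]_n := invmx P *m delta_mx i 0.
have q0 i : 0 <= quad_form P (w i) + 1 by rewrite addr_ge0.
(* A sum of nonnegative bounds dominates each of them and is still nonnegative in dimension zero. *)
exists (\sum_i (quad_form P (w i) + 1)); first exact: sumr_ge0.
move=> v i v1.
have -> : v i 0 = bform P v (w i).
  by rewrite /bform -mulmxA mulKVmx ?posdef_unitmx // -colE !mxE.
have bound e : e ^+ 2 = 1 -> - e * bform P v (w i) <= quad_form P (w i) + 1.
  move=> e2; have := pP (w i + e *: v).
  rewrite quad_formDZ e2 (bform_sym _ _ _ v (w i) sP).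
  have := pP v; have := pP (w i); lra.
apply: (@le_trans _ _ (quad_form P (w i) + 1)).
  rewrite ler_norml; apply/andP; split.
    by have := bound 1 (expr1n _ _); lra.
  by have := bound (-1); rewrite sqrrN expr1n => /(_ erefl); lra.
by rewrite (bigD1 i) //= lerDl sumr_ge0.
Qed.

(** The norm is the sup norm, so coordinate bounds give boundedness. Row vectors match the type in
    [EVT_max_rV]. *)
Lemma posdef_ball_compact (R : realType) n (P : 'M[R]_n) : posdef P ->
  compact [set v : 'rV[R]_n | quad_form P v^T <= 1].
Proof.
move=> hP; apply: bounded_closed_compact.
  have [k k0 hk] := posdef_coord_bounded _ _ _ hP.
  exists k; split; first exact: num_real.
  move=> x kx v /= v1.
  have vx j : `|v 0 j| <= x.
    by apply: le_trans (ltW kx); have := hk v^T j v1; rewrite mxE.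
  rewrite [`|v|]mx_normrE; apply/bigmax_leP.
  split; first exact: le_trans (ltW kx).
  by move=> [i j] _ /=; rewrite (ord1 i).
apply: (preimage_closed _ (@closed_le _ 1)) => v _.
apply: continuous_quad_form => i {}v.
rewrite (_ : (fun x : 'rV[R]_n => _) = (fun x => x 0 i)).
  exact: coord_continuous.
by apply/funext => x; rewrite mxE.
Qed.

Lemma posdef_ball_argmax (R : realType) m n (P : 'M[R]_m) (X : 'M[R]_n)
    (M : 'M[R]_(n, m)) b : posdef P ->
  exists2 z, quad_form P z <= 1 &
    forall z', quad_form P z' <= 1 ->
      quad_form X (M *m z' + b) <= quad_form X (M *m z + b).
Proof.
move=> hP.
have B0 : [set v : 'rV[R]_m | quad_form P v^T <= 1] !=set0.
  by exists 0; rewrite /= trmx0 quad_form0.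
have [|z zP zmax] := @EVT_max_rV R m (fun v => quad_form X (M *m v^T + b)) _
  B0 (posdef_ball_compact _ _ _ hP).
  apply/continuous_subspaceT/continuous_quad_form => i.
  exact: continuous_affine_coord.
exists z^T; first by rewrite inE in zP.
by move=> z' z1; have := zmax z'^T; rewrite trmxK; apply; rewrite inE /= trmxK.
Qed.

(** * Existence of a multiplier for a valid bound *)

Lemma schur_mx_max_feasible (R : realType) m n (P : 'M[R]_m) (M : 'M[R]_(n, m))
    b J : posdef P ->
  (forall z, quad_form P z <= 1 -> quad_form 1%:M (M *m z + b) <= J) ->
  exists2 y, 0 <= y & psd (schur_mx (y *: P) (J - y) M b 1%:M).
Proof.
move=> hP hJ; have [sP pP] := hP.
(* The second coordinate homogenises the affine map; [R^o] makes the pair a module over [R]. *)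
pose F (y : 'cV[R]_m * R^o) : R :=
  quad_form 1%:M (M *m y.1 + y.2 *: b) - J * y.2 ^+ 2.
pose G (y : 'cV[R]_m * R^o) : R := quad_form P y.1 - y.2 ^+ 2.
have qF : quadratic F.
  move=> u v; set p := M *m u.1 + u.2 *: b; set q := M *m v.1 + v.2 *: b.
  exists (bform 1%:M p q + bform 1%:M q p - 2 * J * u.2 * v.2) => s.
  have E : M *m (u + s *: v).1 + (u + s *: v).2 *: b = p + s *: q.
    by rewrite /= mulmxDr scalerDl -scalemxAr scalerDr scalerA addrACA.
  by rewrite /F E quad_formDZ -/p -/q /= -[s *: v.2]/(s * v.2); ring.
have qG : quadratic G.
  move=> u v; exists (bform P u.1 v.1 + bform P v.1 u.1 - 2 * u.2 * v.2) => s.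
  by rewrite /G /= quad_formDZ -[s *: v.2]/(s * v.2); ring.
have G01 : G (0, 1) < 0 by rewrite /G /= quad_form0; lra.
have GF y : G y <= 0 -> F y <= 0.
  (* If [t = 0], definiteness of [P] forces [z = 0]; otherwise dividing by [t] brings [z] into the
     unit ball of [P]. *)
  case: y => z t; rewrite /G /F /= => Gzt; have [t0|t0] := eqVneq t 0.
    have [z0|/pP] := eqVneq z 0; last by move: Gzt; rewrite t0; lra.
    by rewrite t0 z0 mulmx0 scale0r addr0 quad_form0; lra.
  have t2 : 0 < t ^+ 2 by rewrite exprn_even_gt0.
  have -> : M *m z + t *: b = t *: (M *m (t^-1 *: z) + b).
    by rewrite scalerDr -scalemxAr scalerA mulfV // scale1r.
  rewrite quad_formZ mulrC -mulrBl pmulr_lle0 // subr_le0 hJ //.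
  by rewrite quad_formZ exprVn mulrC ler_pdivrMr // mul1r -subr_le0.
have [y y0 FG] := s_lemma _ _ _ _ _ qF qG G01 GF.
by exists y => //; apply: schur_mx_psd => // z t; exact: (FG (z, t)).
Qed.

(** * The constraints as instances, and the conclusion *)

Lemma cost_lmiE (R : realType) nx nu q (P : 'M[R]_nx) c
    (L : 'M[R]_(q, nx + nu + 1)) K (l : 'cV[R]_nu) y J :
  cost_lmi P c L K l y J =
  schur_mx (y *: P) (J - y) (L *m col_mx (col_mx 1%:M K) 0)
    (L *m col_mx (col_mx c l) 1%:M) 1%:M.
Proof.
rewrite /cost_lmi /schur_mx !tr_row_mx !trmx1 trmx0 !trmxK.
by rewrite !trmx_mul !tr_col_mx !trmx1 trmx0.
Qed.

Lemma input_lmiE (R : realType) nx nu p (P : 'M[R]_nx) (U : 'M[R]_(p, nu)) K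
    (l : 'cV[R]_nu) t :
  input_lmi P U K l t = schur_mx (t *: P) (1 - t) (U *m K) (U *m l) 1%:M.
Proof. by rewrite /schur_mx !trmx_mul. Qed.

(** The stacked vector of [x], the input and 1 is affine in [x - c], with linear part (I, K, 0) and
    constant part (c, l, 1). *)
Lemma stage_cost_controller (R : realType) nx nu q
    (L : 'M[R]_(q, nx + nu + 1)) K (l : 'cV[R]_nu) (c x : 'cV[R]_nx) :
  stage_cost (L^T *m L) x (controller K l c x) =
  quad_form 1%:M (L *m col_mx (col_mx 1%:M K) 0 *m (x - c)
                  + L *m col_mx (col_mx c l) 1%:M).
Proof.
rewrite /stage_cost -[L^T in LHS]mulmx1 quad_form_gram -mulmxA -mulmxDr.
by rewrite !mul_col_mx !add_col_mx mul1mx mul0mx add0r subrK.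
Qed.

Theorem corollary1 (R : realType) (nx nu Nw Nu q : nat) (p : 'I_Nu -> nat)
    (A : 'M[R]_nx) (B : 'M[R]_(nx, nu)) (g : 'cV[R]_nx)
    (w : 'I_Nw -> 'cV[R]_nx)
    (P Pf : 'M[R]_nx) (c cf : 'cV[R]_nx)
    (U : forall i : 'I_Nu, 'M[R]_(p i, nu))
    (L : 'M[R]_(q, nx + nu + 1)) (Q : 'M[R]_(nx + nu + 1))
    (hP : posdef P) (hPf : posdef Pf)
    (hQ : psd Q) (hQL : Q = L^T *m L)
    (d : decision R nx nu Nw Nu)
    (hd : is_minimizer (@cost_bound R nx nu Nw Nu)
            (feasible A B g w P Pf c cf U L) d) :
  let kappa := controller (gain d) (offset d) c in
  is_maximum [set stage_cost Q x (kappa x) | x in ellipsoid P c] (cost_bound d)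
  /\
  (forall x : 'cV[R]_nx, ellipsoid P c x ->
     input_set U (kappa x) /\
     forall om : 'cV[R]_nx, convex_hull w om ->
       ellipsoid Pf cf (affine_step A B g x (kappa x) om)).
Proof.
move=> kappa; have [[[b0 t0 y0 _] [lmiT lmiU lmiC]] dmin] := hd.
have sym1 n : (1%:M : 'M[R]_n) \is symmetricmx.
  by apply/symmetricP; rewrite tr_scalar_mx.
split.
  rewrite hQL; set M := L *m col_mx (col_mx 1%:M (gain d)) 0.
  set m := L *m col_mx (col_mx c (offset d)) 1%:M.
  have [z zP zmax] := posdef_ball_argmax _ _ _ _ 1%:M M m hP.
  have ub x : ellipsoid P c x ->
      stage_cost (L^T *m L) x (kappa x) <= cost_bound d.
    rewrite /kappa stage_cost_controller.
    apply: (schur_mx_bound _ _ _ _ _ 1%:M _ _ _ _ _ _ _ y0) => //.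
      by rewrite !mulmx1.
    by rewrite -cost_lmiE.
  split; last by move=> _ [x xP <-]; exact: ub.
  exists (z + c); first by rewrite /ellipsoid /= addrK.
  apply/eqP; rewrite eq_le ub /ellipsoid /= ?addrK //=.
  rewrite /kappa stage_cost_controller addrK.
  have [y' y'0 lmi'] := schur_mx_max_feasible _ _ _ _ _ _ _ hP zmax.
  (* The omitted bound is the attained maximum, read off the goal; the unchanged gain and offset
     keep the other constraints valid. *)
  apply: (dmin (Decision (gain d) (offset d) (beta d) (tau d) y' _)).
  split; split => //=; first exact: quad_form1_ge0.
  by rewrite cost_lmiE.
move=> x xP; split.
  move=> i _ /=; rewrite /norm2 -quad_form1 -[leRHS]sqrtr1 ler_sqrt //.
  rewrite /kappa /controller mulmxDr mulmxA.
  apply: (schur_mx_bound _ _ _ _ _ 1%:M _ _ _ _ _ _ _ (t0 i) _ xP) => //.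
    by rewrite !mulmx1.
  by rewrite -input_lmiE.
move=> om [a [a0 a1 ->]]; rewrite /ellipsoid /=.
(* Since the weights sum to 1, the terms independent of the disturbance move under the sum. *)
have -> : affine_step A B g x (kappa x) (\sum_i a i *: w i) - cf =
    \sum_i a i *: (affine_step A B g x (kappa x) (w i) - cf).
  rewrite /affine_step.
  under [RHS]eq_bigr do rewrite -addrA scalerDr scalerBr.
  rewrite !big_split /= -scaler_suml a1 scale1r sumrN -scaler_suml a1 scale1r.
  by rewrite addrA.
apply: quad_form_convex => // [|i]; first exact: posdef_psd.
(* Centring at [c] exposes the blocks [A + B *m gain d] and [mu] of [transition_lmi]. *)
have -> : affine_step A B g x (kappa x) (w i) - cf =
    (A + B *m gain d) *m (x - c)
    + (g + A *m c + B *m offset d + w i - cf).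
  rewrite /affine_step /kappa /controller -[in A *m x](subrK c x).
  move: (x - c) => e; rewrite mulmxDl !mulmxDr mulmxA.
  move: (A *m e) (A *m c) (B *m _ *m e) (B *m offset d) => v1 v2 v3 v4.
  by apply/matrixP => k l; rewrite !mxE; ring.
apply: schur_mx_bound (b0 i) (lmiT i) xP; first by case: hPf.
by rewrite mulmxV ?posdef_unitmx // mul1mx.
Qed.
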